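(* Let $G$ be a metrizable, locally uniform topological group. Then any two metric nonstandard hulls of $G$ are locally isomorphic; that is, if $d$ and $d'$ are compatible left-invariant metrics on $G$, and $U=\{x\in G:d(x,e)<r\}$ and $U'=\{x\in G:d'(x,e)<r'\}$ ($r,r'\in\mathbb{R}^{>0}$) are such that $G$ is both $U$-locally uniform and $U'$-locally uniform, then the local groups $\hat U_d$ and $\hat U'_{d'}$ are locally isomorphic.
   Context: $X^*$ is the nonstandard extension of $X$ in a sufficiently saturated nonstandard universe; $\mathbb{R}_f\subseteq\mathbb{R}^*$ is the set of finite hyperreals, $\operatorname{st}$ the standard part map. Topological groups are Hausdorff, with identity $e$. Local groups: a local group is a Hausdorff space $H$ with a distinguished element $1$, a continuous product $\Omega_H\to H$ with $\Omega_H\subseteq H\times H$ open, and a continuous inversion $\Lambda_H\to H$ with $\Lambda_H\subseteq H$ open, such that $1\in\Lambda_H$, $\{1\}\times H\subseteq\Omega_H$, $H\times\{1\}\subseteq\Omega_H$, $1x=x1=x$; for $x\in\Lambda_H$, $(x,x^{-1}),(x^{-1},x)\in\Omega_H$ and $xx^{-1}=x^{-1}x=1$; and $(xy)z=x(yz)$ whenever $(x,y),(y,z),(xy,z),(x,yz)\in\Omega_H$. The restriction $H|N$ to a symmetric open neighborhood $N$ of $1$ has underlying space $N$ and product domain $\{(x,y)\in\Omega_H\cap(N\times N):xy\in N\}$. An isomorphism is a homeomorphism matching identity, inversion, product domains and products. Two local groups are locally isomorphic if they have isomorphic restrictions to symmetric open neighborhoods of the identities. For a symmetric open neighborhood $U$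 of $e$, $G$ is $U$-locally uniform if there is a uniformity on $G$ compatible with the topology such that multiplication $U^2\times U^2\to U^4$ is uniformly continuous ($U^n=\{x_1\cdots x_n:x_i\in U\}$); $G$ is locally uniform if this holds for some $U$. Let $\mu=\bigcap\{O^*:O\text{ an open neighborhood of }e\}$; for $x,y\in G^*$, $x\approx_l y$ iff $x^{-1}y\in\mu$; $\mu(x)=\{y\in G^*:x\approx_l y\}$. Metric nonstandard hull: for a compatible left-invariant metric $d$ and $U=\{x\in G:d(x,e)<r\}$ such that $G$ is $U$-locally uniform, let $U_{d,f}=\{x\in U^*:\mu(x)\subseteq U^*,\ d(x,e)\in\mathbb{R}_f\}$, let $[x]$ be the $\approx_l$-class of $x$, and $\hat U_d=\{[x]:x\in U_{d,f}\}$ with metric $\hat d([x],[y])=\operatorname{st}(d(x,y))$, product domain $\{([x],[y]):xy\in U_{d,f}\}$, product $[x][y]=[xy]$, inversion $[x]^{-1}=[x^{-1}]$ and identity $[e]$; this is a local group. *)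

(* Defs.v *)
From HB Require Import structures.
From mathcomp Require Import all_boot all_order all_algebra lra.
From mathcomp Require Import boolp classical_sets functions cardinality.
From mathcomp Require Import interval_inference reals topology.

Set Implicit Arguments.
Unset Strict Implicit.
Unset Printing Implicit Defensive.

Import Order.TTheory GRing.Theory Num.Theory.

Local Open Scope classical_set_scope.
Local Open Scope ring_scope.

(* A nonstandard extension X |-> X^* of all sets X, with their subsets and
   functions, in Henson's axiomatic form: A |-> A^* commutes with the Boolean
   operations, singletons, products, diagonals and projections, which amounts to
   the transfer principle for first-order formulas. An element A of (set X)^*
   encodes the internal subset of X^* of those x with (x, A) in the extension
   of the membership relation. The last axiom is aleph_1-saturation, the least
   amount of saturation that "sufficiently saturated" can mean. *)
Record nonstandard_universe := NonstandardUniverse {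
  star : Type -> Type;
  std : forall X : Type, X -> star X;
  starset : forall X : Type, set X -> set (star X);
  starmap : forall X Y : Type, (X -> Y) -> star X -> star Y;
  starpair : forall X Y : Type, star X -> star Y -> star (X * Y);
  starmap_id : forall X (x : star X), starmap id x = x;
  starmap_comp : forall X Y Z (g : Y -> Z) (f : X -> Y) (x : star X),
    starmap (g \o f) x = starmap g (starmap f x);
  starpair_fst : forall X Y (x : star X) (y : star Y),
    starmap fst (starpair x y) = x;
  starpair_snd : forall X Y (x : star X) (y : star Y),
    starmap snd (starpair x y) = y;
  starpair_eta : forall X Y (z : star (X * Y)),
    starpair (starmap fst z) (starmap snd z) = z;
  starset1 : forall X (x : X), starset [set x] = [set std x];
  starsetI : forall X (A B : set X),
    starset (A `&` B) = starset A `&` starset B;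
  starsetC : forall X (A : set X), starset (~` A) = ~` starset A;
  starset_diag : forall X,
    starset [set z : X * X | z.1 = z.2] =
    [set z | starmap fst z = starmap snd z];
  starset_preimage : forall X Y (f : X -> Y) (B : set Y),
    starset (f @^-1` B) = starmap f @^-1` starset B;
  starset_image : forall X Y (f : X -> Y) (A : set X),
    starset (f @` A) = starmap f @` starset A;
  countable_saturation : forall X (A : nat -> star (set X)),
    (forall n, exists x, forall k, (k < n)%N ->
       starset [set z : X * set X | z.2 z.1] (starpair x (A k))) ->
    exists x, forall k,
       starset [set z : X * set X | z.2 z.1] (starpair x (A k))
}.

Section transfer.
Context {V : nonstandard_universe}.

(* The extension of a function of two variables *)
Definition starmap2 X Y Z (h : X -> Y -> Z) (x : star V X) (y : star V Y) :
    star V Z :=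
  starmap (fun z => h z.1 z.2) (starpair x y).

(* The extension of a binary relation *)
Definition starrel X Y (P : X -> Y -> Prop) (x : star V X) (y : star V Y) :=
  starset [set z : X * Y | P z.1 z.2] (starpair x y).

Lemma starsetT X (x : star V X) : starset setT x.
Proof.
rewrite -(setCK [set: X]) setCT -(setICr set0) starsetC starsetI starsetC.
by move=> [].
Qed.

Lemma starsetS X (A B : set X) : A `<=` B -> starset A `<=` @starset V X B.
Proof. by move=> /setIidPl <-; rewrite starsetI => x []. Qed.

Lemma starset_all X (A : set X) (x : star V X) : (forall t, A t) -> starset A x.
Proof. by move=> h; apply: (@starsetS X setT) (starsetT x). Qed.

Lemma starset_app2 X (A B C : set X) (x : star V X) :
  (forall t, A t -> B t -> C t) -> starset A x -> starset B x -> starset C x.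
Proof.
move=> h a b; apply: (@starsetS X (A `&` B)); first by move=> t [? ?]; apply: h.
by rewrite starsetI.
Qed.

Lemma starsetE X Y (f : X -> Y) (B : set Y) (x : star V X) :
  starset B (starmap f x) = starset [set t | B (f t)] x.
Proof. by rewrite -[RHS]/(starset (f @^-1` B) x) starset_preimage. Qed.

Lemma starset_not X (A : set X) (x : star V X) :
  starset [set t | ~ A t] x = ~ starset A x.
Proof. by rewrite -[LHS]/(starset (~` A) x) starsetC. Qed.

Lemma starmap_cst X Y (b : Y) (x : star V X) : starmap (fun=> b) x = std V b.
Proof.
have : starset [set b] (starmap (fun=> b) x) by rewrite starsetE; apply: starset_all.
by rewrite starset1.
Qed.

Lemma starset_std X (A : set X) (x : X) : starset A (std V x) <-> A x.
Proof.
have h : starset [set x] (std V x) by rewrite starset1.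
split=> Ax; last by apply: starsetS h => _ ->.
apply: contrapT => nAx; have : starset (~` A) (std V x).
  by apply: starsetS h => _ ->.
by rewrite starsetC; apply.
Qed.

Lemma starpair_map X Y Z (f : X -> Y) (g : X -> Z) (x : star V X) :
  starpair (starmap f x) (starmap g x) = starmap (fun t => (f t, g t)) x.
Proof. by rewrite -[RHS]starpair_eta -!starmap_comp. Qed.

Lemma starmapE X Y Z (g : Y -> Z) (f : X -> Y) (x : star V X) :
  starmap g (starmap f x) = starmap (fun t => g (f t)) x.
Proof. by rewrite -starmap_comp. Qed.

Lemma starmap2E X Y Z W (h : Y -> Z -> W) (f : X -> Y) (g : X -> Z)
    (x : star V X) :
  starmap2 h (starmap f x) (starmap g x) = starmap (fun t => h (f t) (g t)) x.
Proof. by rewrite /starmap2 starpair_map starmapE. Qed.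

Lemma starrelE X Y Z (P : Y -> Z -> Prop) (f : X -> Y) (g : X -> Z)
    (x : star V X) :
  starrel P (starmap f x) (starmap g x) = starset [set t | P (f t) (g t)] x.
Proof. by rewrite /starrel starpair_map starsetE. Qed.

Lemma starmap_ext X Y (f g : X -> Y) (x : star V X) :
  f =1 g -> starmap f x = starmap g x.
Proof. by move=> /funext ->. Qed.

Lemma star_split2 X Y (x : star V X) (y : star V Y) :
  exists p : star V (X * Y), x = starmap fst p /\ y = starmap snd p.
Proof. by exists (starpair x y); rewrite starpair_fst starpair_snd. Qed.

Lemma star_split3 X Y Z (x : star V X) (y : star V Y) (z : star V Z) :
  exists p : star V (X * Y * Z),
  [/\ x = starmap (fun t => t.1.1) p, y = starmap (fun t => t.1.2) p &
      z = starmap snd p].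
Proof.
have [q [-> ->]] := star_split2 x y; have [p [-> ->]] := star_split2 q z.
by exists p; rewrite !starmapE.
Qed.

Lemma star_split4 X Y Z W (x : star V X) (y : star V Y) (z : star V Z)
    (w : star V W) :
  exists p : star V (X * Y * Z * W),
  [/\ x = starmap (fun t => t.1.1.1) p, y = starmap (fun t => t.1.1.2) p,
      z = starmap (fun t => t.1.2) p & w = starmap snd p].
Proof.
have [q [-> -> ->]] := star_split3 x y z; have [p [-> ->]] := star_split2 q w.
by exists p; rewrite !starmapE.
Qed.

(* Overspill for a decreasing sequence of internal sets, given as the values
   at p of a standard family *)
Lemma overspill X P (B : nat -> P -> set X) (p : star V P) :
  (forall m n t, (m <= n)%N -> B n t `<=` B m t) ->
  (forall n, exists x, starrel (fun x t => B n t x) x p) ->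
  exists x, forall n, starrel (fun x t => B n t x) x p.
Proof.
move=> Bd Bn; pose A n := starmap (B n) p.
have AE n x : starset [set z : X * set X | z.2 z.1] (starpair x (A n)) =
    starrel (fun x t => B n t x) x p.
  rewrite /A; have [q [-> ->]] := star_split2 x p.
  by rewrite starmapE starpair_map starsetE starrelE.
have [n|x xA] := countable_saturation (A := A).
  have [x xn] := Bn n; exists x => k kn; rewrite AE.
  by move: xn; apply: starsetS => -[/= y t]; apply: Bd; apply: ltnW.
by exists x => n; rewrite -AE.
Qed.

End transfer.

(* The partial product and inversion are total functions with explicit domains;
   their values outside the domains are irrelevant. *)
Record localGroup := LocalGroup {
  lg_sort :> topologicalType;
  lg_one : lg_sort;
  lg_mul : lg_sort -> lg_sort -> lg_sort;
  lg_muldom : set (lg_sort * lg_sort);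
  lg_inv : lg_sort -> lg_sort;
  lg_invdom : set lg_sort;
  lg_hausdorff : hausdorff_space lg_sort;
  lg_muldom_open : open lg_muldom;
  lg_mul_continuous :
    {within lg_muldom, continuous (fun z => lg_mul z.1 z.2)};
  lg_invdom_open : open lg_invdom;
  lg_inv_continuous : {within lg_invdom, continuous lg_inv};
  lg_invdom1 : lg_invdom lg_one;
  lg_muldom1l : forall x, lg_muldom (lg_one, x);
  lg_muldom1r : forall x, lg_muldom (x, lg_one);
  lg_mul1l : forall x, lg_mul lg_one x = x;
  lg_mul1r : forall x, lg_mul x lg_one = x;
  lg_muldomVr : forall x, lg_invdom x -> lg_muldom (x, lg_inv x);
  lg_muldomVl : forall x, lg_invdom x -> lg_muldom (lg_inv x, x);
  lg_mulVr : forall x, lg_invdom x -> lg_mul x (lg_inv x) = lg_one;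
  lg_mulVl : forall x, lg_invdom x -> lg_mul (lg_inv x) x = lg_one;
  lg_mulA : forall x y z,
    lg_muldom (x, y) -> lg_muldom (y, z) ->
    lg_muldom (lg_mul x y, z) -> lg_muldom (x, lg_mul y z) ->
    lg_mul (lg_mul x y) z = lg_mul x (lg_mul y z)
}.

Arguments lg_one : clear implicits.
Arguments lg_mul {l}.
Arguments lg_muldom : clear implicits.
Arguments lg_inv {l}.
Arguments lg_invdom : clear implicits.

Definition lg_symmetric (H : localGroup) (N : set H) :=
  N `<=` lg_invdom H /\ [set lg_inv x | x in N] = N.

Definition lg_symmetric_open_nbhd (H : localGroup) (N : set H) :=
  [/\ open N, N (lg_one H) & lg_symmetric N].

Section restriction.
Variables (H : localGroup) (N : set H).
Hypothesis Nnbhd : lg_symmetric_open_nbhd N.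

Let N1 : N (lg_one H). Proof. by case: Nnbhd. Qed.

Definition lgr_one : N := SigSub (mem_set N1).

Lemma lgr_val1 : set_val lgr_one = lg_one H. Proof. by []. Qed.

Definition lgr_in (x : H) : N := insubd lgr_one x.

Definition lgr_mul (x y : N) : N := lgr_in (lg_mul (set_val x) (set_val y)).

Definition lgr_inv (x : N) : N := lgr_in (lg_inv (set_val x)).

Definition lgr_muldom : set (N * N) :=
  [set z | lg_muldom H (set_val z.1, set_val z.2) /\
           N (lg_mul (set_val z.1) (set_val z.2))].

Lemma lgr_inK (x : H) : N x -> set_val (lgr_in x) = x.
Proof. by move=> Nx; rewrite set_valE /lgr_in insubdK// mem_set. Qed.

Lemma lgr_val_inj : injective (set_val : N -> H).
Proof. exact: val_inj. Qed.

Lemma lgr_valP (x : N) : N (set_val x).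
Proof. exact: set_valP. Qed.

Lemma lgr_inv_in (x : N) : N (lg_inv (set_val x)).
Proof.
case: Nnbhd => _ _ [_ /seteqP[NV _]]; apply: NV; exists (set_val x) => //.
exact: lgr_valP.
Qed.

Lemma lgr_val_continuous : continuous (set_val : N -> H).
Proof. exact: initial_continuous. Qed.

Lemma lgr_openP (A : set N) :
  open A <-> exists2 B : set H, open B & set_val @^-1` B = A.
Proof. by split=> -[B oB BA]; exists B. Qed.

Let val2 (z : N * N) : H * H := (set_val z.1, set_val z.2).

Let val2_continuous : continuous val2.
Proof.
move=> z; apply: cvg_pair.
  by apply: (cvg_comp _ _ cvg_fst); apply: lgr_val_continuous.
by apply: (cvg_comp _ _ cvg_snd); apply: lgr_val_continuous.
Qed.

Lemma lg_mul_preim_open (B : set H) : open B ->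
  open (lg_muldom H `&` [set z | B (lg_mul z.1 z.2)]).
Proof.
move=> oB; have := @lg_mul_continuous H.
rewrite continuous_open_subspace; last exact: lg_muldom_open.
by move/(continuous_inP _ (@lg_muldom_open H)); apply.
Qed.

Lemma lg_inv_preim_open (B : set H) : open B ->
  open (lg_invdom H `&` [set z | B (lg_inv z)]).
Proof.
move=> oB; have := @lg_inv_continuous H.
rewrite continuous_open_subspace; last exact: lg_invdom_open.
by move/(continuous_inP _ (@lg_invdom_open H)); apply.
Qed.

Let lgr_hausdorff : hausdorff_space N.
Proof.
move=> p q pq; apply: lgr_val_inj; apply: (@lg_hausdorff H) => A B Ap Bq.
have [||x [Ax Bx]] := pq (set_val @^-1` A) (set_val @^-1` B).
- exact: lgr_val_continuous.
- exact: lgr_val_continuous.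
- by exists (set_val x).
Qed.

Let lgr_muldom_open : open lgr_muldom.
Proof.
have oN : open N by case: Nnbhd.
rewrite (_ : lgr_muldom = val2 @^-1` (lg_muldom H `&`
   [set z | N (lg_mul z.1 z.2)])) //.
have /continuousP : continuous val2 by exact: val2_continuous.
by apply; apply: lg_mul_preim_open.
Qed.

Let lgr_mul_continuous :
  {within lgr_muldom, continuous (fun z => lgr_mul z.1 z.2)}.
Proof.
rewrite continuous_open_subspace//; apply/(continuous_inP _ lgr_muldom_open).
move=> A /lgr_openP [B oB <-].
rewrite (_ : _ `&` _ = lgr_muldom `&` val2 @^-1` (lg_muldom H `&`
   [set z | B (lg_mul z.1 z.2)])).
  apply: openI => //; have /continuousP : continuous val2 by exact: val2_continuous.
  by apply; apply: lg_mul_preim_open.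
apply/seteqP; split=> z -[zd]; rewrite /preimage/= /lgr_mul; have [z1 z2] := zd.
  by rewrite lgr_inK.
by move=> [_ h]; split=> //; rewrite lgr_inK.
Qed.

Let lgr_inv_continuous : {within setT, continuous lgr_inv}.
Proof.
rewrite continuous_open_subspace; last exact: openT.
apply/(continuous_inP _ openT).
move=> A /lgr_openP [B oB <-].
rewrite (_ : _ `&` _ = set_val @^-1` (lg_invdom H `&` [set z | B (lg_inv z)])).
  have /continuousP : continuous (set_val : N -> H) by exact: lgr_val_continuous.
  by apply; apply: lg_inv_preim_open.
case: Nnbhd => _ _ [Ninv _].
apply/seteqP; split=> z []; rewrite /preimage/= /lgr_inv lgr_inK;
  try exact: lgr_inv_in; move=> h1 h2; split=> //.
by apply: Ninv; apply: lgr_valP.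
Qed.

Let Ninvdom (x : N) : lg_invdom H (set_val x).
Proof. by case: Nnbhd => _ _ [h _]; apply: h; apply: lgr_valP. Qed.

Let lgr_muldom1l : forall x, lgr_muldom (lgr_one, x).
Proof.
move=> x; split=> /=; first exact: lg_muldom1l.
by rewrite lgr_val1 lg_mul1l; apply: lgr_valP.
Qed.

Let lgr_muldom1r : forall x, lgr_muldom (x, lgr_one).
Proof.
move=> x; split=> /=; first exact: lg_muldom1r.
by rewrite lgr_val1 lg_mul1r; apply: lgr_valP.
Qed.

Let lgr_mul1l : forall x, lgr_mul lgr_one x = x.
Proof.
move=> x; apply: lgr_val_inj; rewrite /lgr_mul lgr_val1.
by rewrite lg_mul1l lgr_inK//; apply: lgr_valP.
Qed.

Let lgr_mul1r : forall x, lgr_mul x lgr_one = x.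
Proof.
move=> x; apply: lgr_val_inj; rewrite /lgr_mul lgr_val1.
by rewrite lg_mul1r lgr_inK//; apply: lgr_valP.
Qed.

Let lgr_muldomVr : forall x, [set: N] x -> lgr_muldom (x, lgr_inv x).
Proof.
move=> x _; rewrite /lgr_muldom /lgr_inv/= lgr_inK; last exact: lgr_inv_in.
by split; [apply: lg_muldomVr|rewrite lg_mulVr].
Qed.

Let lgr_muldomVl : forall x, [set: N] x -> lgr_muldom (lgr_inv x, x).
Proof.
move=> x _; rewrite /lgr_muldom /lgr_inv/= lgr_inK; last exact: lgr_inv_in.
by split; [apply: lg_muldomVl|rewrite lg_mulVl].
Qed.

Let lgr_mulVr : forall x, [set: N] x -> lgr_mul x (lgr_inv x) = lgr_one.
Proof.
move=> x _; apply: lgr_val_inj; rewrite /lgr_mul /lgr_inv lgr_inK.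
  by rewrite lgr_inK; [rewrite lg_mulVr|apply: lgr_inv_in].
by rewrite lgr_inK; [rewrite lg_mulVr|apply: lgr_inv_in].
Qed.

Let lgr_mulVl : forall x, [set: N] x -> lgr_mul (lgr_inv x) x = lgr_one.
Proof.
move=> x _; apply: lgr_val_inj; rewrite /lgr_mul /lgr_inv lgr_inK.
  by rewrite lgr_inK; [rewrite lg_mulVl|apply: lgr_inv_in].
by rewrite lgr_inK; [rewrite lg_mulVl|apply: lgr_inv_in].
Qed.

Let lgr_mulA : forall x y z, lgr_muldom (x, y) -> lgr_muldom (y, z) ->
  lgr_muldom (lgr_mul x y, z) -> lgr_muldom (x, lgr_mul y z) ->
  lgr_mul (lgr_mul x y) z = lgr_mul x (lgr_mul y z).
Proof.
move=> x y z [xy Nxy] [yz Nyz]; rewrite /lgr_muldom/= /lgr_mul.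
rewrite !(lgr_inK Nxy) !(lgr_inK Nyz) => -[xyz _] [xyz' _].
by congr lgr_in; apply: lg_mulA.
Qed.

Definition lg_restrict : localGroup := {|
  lg_sort := N;
  lg_one := lgr_one;
  lg_mul := lgr_mul;
  lg_muldom := lgr_muldom;
  lg_inv := lgr_inv;
  lg_invdom := setT;
  lg_hausdorff := lgr_hausdorff;
  lg_muldom_open := lgr_muldom_open;
  lg_mul_continuous := lgr_mul_continuous;
  lg_invdom_open := openT;
  lg_inv_continuous := lgr_inv_continuous;
  lg_invdom1 := I;
  lg_muldom1l := lgr_muldom1l;
  lg_muldom1r := lgr_muldom1r;
  lg_mul1l := lgr_mul1l;
  lg_mul1r := lgr_mul1r;
  lg_muldomVr := lgr_muldomVr;
  lg_muldomVl := lgr_muldomVl;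
  lg_mulVr := lgr_mulVr;
  lg_mulVl := lgr_mulVl;
  lg_mulA := lgr_mulA
|}.

End restriction.

Definition lg_isomorphic (H K : localGroup) :=
  exists (f : H -> K) (g : K -> H),
    [/\ cancel f g, cancel g f, continuous f & continuous g] /\
    [/\ f (lg_one H) = lg_one K,
        (forall x, lg_invdom H x <-> lg_invdom K (f x)),
        (forall x, lg_invdom H x -> f (lg_inv x) = lg_inv (f x)),
        (forall x y, lg_muldom H (x, y) <-> lg_muldom K (f x, f y)) &
        (forall x y, lg_muldom H (x, y) -> f (lg_mul x y) = lg_mul (f x) (f y))].

Definition lg_locally_isomorphic (H K : localGroup) :=
  exists (M : set H) (N : set K)
    (hM : lg_symmetric_open_nbhd M) (hN : lg_symmetric_open_nbhd N),
    lg_isomorphic (lg_restrict hM) (lg_restrict hN).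

HB.mixin Record isTopologicalGroup G & Group G & Topological G := {
  mulg_continuous : continuous (fun z : G * G => (z.1 * z.2)%g);
  invg_continuous : continuous (fun x : G => (x^-1)%g);
  topgroup_hausdorff : hausdorff_space G
}.

#[short(type="topGroupType")]
HB.structure Definition TopologicalGroup :=
  { G of Group G & Topological G & isTopologicalGroup G }.

Section uniformity.
Local Open Scope relation_scope.

(* The axioms of the library's uniformType, for a uniformity that is not fixed
   as part of the type *)
Record compatible_uniformity (T : topologicalType) (E : set_system (T * T))
    : Prop := CompatibleUniformity {
  cu_filter : Filter E;
  cu_diagonal : forall A, E A -> diagonal `<=` A;
  cu_inv : forall A, E A -> E A^-1;
  cu_split : forall A, E A -> exists2 B, E B & B \; B `<=` A;
  cu_nbhs : @nbhs T T = nbhs_ E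
}.

End uniformity.

Definition set_power (G : groupType) (U : set G) (n : nat) : set G :=
  [set x | exists2 f : 'I_n -> G,
     (forall i, U (f i)) & x = (\prod_(i < n) f i)%g].

(* Multiplication U^2 x U^2 -> U^4 is uniformly continuous for the induced
   uniformities. *)
Definition locally_uniform_on (G : topGroupType) (U : set G) :=
  exists E : set_system (G * G), compatible_uniformity E /\
  forall W, E W -> exists2 V, E V & forall x x' y y' : G,
    set_power U 2 x -> set_power U 2 x' ->
    set_power U 2 y -> set_power U 2 y' ->
    V (x, x') -> V (y, y') -> W ((x * y)%g, (x' * y')%g).

Definition locally_uniform (G : topGroupType) :=
  exists U : set G, [/\ open U, U 1%g, [set x^-1%g | x in U] = U &
    locally_uniform_on U].

Record compatible_metric (R : realType) (T : topologicalType)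
    (d : T -> T -> R) : Prop := CompatibleMetric {
  cm_xx : forall x, d x x = 0;
  cm_eq : forall x y, d x y = 0 -> x = y;
  cm_sym : forall x y, d x y = d y x;
  cm_triangle : forall x y z, d x z <= d x y + d y z;
  cm_nbhs : forall x (A : set T),
    nbhs x A <-> exists2 e : R, 0 < e & [set y | d x y < e] `<=` A
}.

Definition metrizable (R : realType) (T : topologicalType) :=
  exists d : T -> T -> R, compatible_metric d.

Record left_invariant_metric (R : realType) (G : topGroupType) :=
  LeftInvariantMetric {
  lim_dist :> G -> G -> R;
  lim_compatible : compatible_metric lim_dist;
  lim_left_invariant : forall g x y : G,
    lim_dist (g * x)%g (g * y)%g = lim_dist x y
}.

Definition metric_ball (R : realType) (G : topGroupType)
    (d : left_invariant_metric R G) (r : R) : set G :=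
  [set x | d x 1%g < r].

Section hyperreal.
Context {V : nonstandard_universe} {R : realType}.

(* The order of the hyperreals *)
Definition hle (x y : star V R) := starrel (fun s t => s <= t) x y.

Definition finite_hyperreal : set (star V R) :=
  [set x | exists r : R, hle (starmap Num.norm x) (std V r)].

Definition is_standard_part (x : star V R) : set R :=
  [set s | forall e : R, 0 < e ->
    hle (starmap Num.norm (starmap2 (fun u v => u - v) x (std V s)))
        (std V e)].

(* The default value 0 is taken only at infinite hyperreals. *)
Definition standard_part (x : star V R) : R := xget 0 (is_standard_part x).

Lemma hle_absE (x : star V R) (c : R) :
  hle (starmap Num.norm x) (std V c) = starset [set t | `|t| <= c] x.
Proof. by rewrite -(starmap_cst c x) /hle starrelE. Qed.

Lemma finite_hyperrealP (x : star V R) :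
  finite_hyperreal x <-> exists c : R, starset [set t | `|t| <= c] x.
Proof. by split=> -[c h]; exists c; move: h; rewrite hle_absE. Qed.

Lemma hle_distE (x : star V R) (s e : R) :
  hle (starmap Num.norm (starmap2 (fun u v => u - v) x (std V s))) (std V e) =
  starset [set t | `|t - s| <= e] x.
Proof.
rewrite hle_absE -(starmap_cst s x) -{1}(starmap_id x) starmap2E starsetE.
by [].
Qed.

Lemma standard_partP (x : star V R) : finite_hyperreal x ->
  forall e, 0 < e -> starset [set t | `|t - standard_part x| <= e] x.
Proof.
move=> /finite_hyperrealP[c xc].
suff [s xs] : exists s : R, forall e, 0 < e -> starset [set t | `|t - s| <= e] x.
  have /(xgetI 0) h : is_standard_part x s.
    by move=> e e0; rewrite hle_distE; apply: xs.
  by move=> e e0; have := h e e0; rewrite hle_distE.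
pose S := [set q : R | starset [set t | q <= t] x].
have S0 : S (- c).
  by apply: starsetS xc => t /=; rewrite ler_norml => /andP[].
have Sub : ubound S c.
  move=> q Sq; rewrite leNgt; apply/negP => cq.
  have : starset (set0 : set R) x.
    apply: (starset_app2 _ xc Sq) => t /=; rewrite ler_norml => /andP[_ tc] qt.
    by have := le_lt_trans (le_trans qt tc) cq; rewrite ltxx.
  by rewrite -setCT starsetC; apply; apply: starsetT.
have hS : has_sup S by split; [exists (- c)|exists c].
exists (sup S) => e e0.
have [q Sq qS] := sup_adherent e0 hS.
have nS : ~ S (sup S + e).
  by move=> /(sup_upper_bound hS); rewrite gerDl leNgt e0.
move: nS; rewrite /S /= -starset_not => nS.
apply: (starset_app2 _ nS Sq) => t /= /negP; rewrite -ltNge => h1 h2.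
by rewrite ler_distl (ltW h1) (le_trans (ltW qS) h2).
Qed.

End hyperreal.

Section monad.
Context {V : nonstandard_universe} {G : topGroupType}.

Definition starmul (x y : star V G) : star V G := starmap2 (fun x y => x * y)%g x y.

Definition starinv (x : star V G) : star V G := starmap (fun x => x^-1)%g x.

(* mu *)
Definition monad1 : set (star V G) :=
  [set x | forall O : set G, open O -> O 1%g -> starset O x].

Definition approx_l (x y : star V G) := monad1 (starmul (starinv x) y).

(* mu(x), which is also the class [x] of x for approx_l *)
Definition monad (x : star V G) : set (star V G) := [set y | approx_l x y].

End monad.

Section metric_monad.
Context {V : nonstandard_universe} {R : realType} {G : topGroupType}.
Variable d : left_invariant_metric R G.
Implicit Types (x y z : star V G) (e : R).

Definition stardist x y : star V R := starmap2 d x y.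

Definition starnear e x y := starrel (fun s t => d s t < e) x y.

Let dxx (t : G) : d t t = 0. Proof. exact: cm_xx (lim_compatible d) t. Qed.
Let dsym (s t : G) : d s t = d t s.
Proof. exact: cm_sym (lim_compatible d) s t. Qed.
Let dtri (s t u : G) : d s u <= d s t + d t u.
Proof. exact: cm_triangle (lim_compatible d) s t u. Qed.

Lemma lim_dist_ge0 (s t : G) : 0 <= d s t.
Proof.
have := dtri s t s; rewrite dxx (dsym t s) -mulr2n.
by rewrite pmulrn_lge0.
Qed.

Lemma starnear_xx e x : 0 < e -> starnear e x x.
Proof.
by move=> e0; rewrite -(starmap_id x) /starnear starrelE; apply: starset_all => t /=; rewrite dxx.
Qed.

Lemma starnear_sym e x y : starnear e x y -> starnear e y x.
Proof.
have [p [-> ->]] := star_split2 x y; rewrite /starnear !starrelE.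
by apply: starsetS => t /=; rewrite dsym.
Qed.

Lemma starnear_le e e' x y : e <= e' -> starnear e x y -> starnear e' x y.
Proof. by move=> ee'; apply: starsetS => t /= /lt_le_trans; apply. Qed.

Lemma starnear_trans e e' x y z :
  starnear e x y -> starnear e' y z -> starnear (e + e') x z.
Proof.
have [p [-> -> ->]] := star_split3 x y z; rewrite /starnear !starrelE.
apply: starset_app2 => t /= h1 h2.
by rewrite (le_lt_trans (dtri _ t.1.2 _))// ltrD.
Qed.

Lemma open_lim_ball (c : G) e : open [set t | d c t < e].
Proof.
rewrite openE => t /= ct; apply/(cm_nbhs (lim_compatible d)).
exists (e - d c t); first by rewrite subr_gt0.
by move=> u /= tu; rewrite (le_lt_trans (dtri _ t _))// addrC -ltrBrDr.
Qed.

Lemma approx_lP x y : approx_l x y <-> forall e, 0 < e -> starnear e x y.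
Proof.
have E (p : star V (G * G)) : starmul (starinv (starmap fst p)) (starmap snd p) =
    starmap (fun t => t.1^-1 * t.2)%g p.
  by rewrite /starmul /starinv starmapE starmap2E.
have dE (s t : G) : d 1%g (s^-1 * t)%g = d s t.
  by rewrite -(lim_left_invariant d s) mulVKg mulg1.
rewrite /approx_l /starnear; have [p [-> ->]] := star_split2 x y.
rewrite E; split=> [h e e0|h O oO O1].
  have := h [set t | d 1%g t < e] (@open_lim_ball _ _).
  rewrite /= dxx => /(_ e0); rewrite starsetE starrelE.
  by apply: starsetS => t /=; rewrite dE.
have /(cm_nbhs (lim_compatible d))[e e0 eO] : nbhs 1%g O by exact: open_nbhs_nbhs.
rewrite starsetE; have := h e e0; rewrite starrelE; apply: starsetS => t /= te.
by apply: eO; rewrite /= dE.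
Qed.

Lemma approx_l_refl x : approx_l x x.
Proof. by apply/approx_lP => e e0; apply: starnear_xx. Qed.

Lemma approx_l_sym x y : approx_l x y -> approx_l y x.
Proof.
by move/approx_lP=> h; apply/approx_lP => e e0; apply: starnear_sym; apply: h.
Qed.

Lemma approx_l_trans y x z : approx_l x y -> approx_l y z -> approx_l x z.
Proof.
move=> /approx_lP h1 /approx_lP h2; apply/approx_lP => e e0.
rewrite (splitr e); apply: (@starnear_trans _ _ _ y).
  by apply: h1; rewrite divr_gt0.
by apply: h2; rewrite divr_gt0.
Qed.

Lemma monad_eqP x y : monad x = monad y <-> approx_l x y.
Proof.
split=> [xy|xy].
  by have : monad y y by [exact: approx_l_refl]; rewrite -xy.
apply/seteqP; split=> z; rewrite /monad/= => h.
  by apply: approx_l_trans h; apply: approx_l_sym.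
exact: approx_l_trans h.
Qed.

Lemma monad_underspill (A : set G) x : monad x `<=` starset A ->
  exists2 e : R, 0 < e & forall y, starnear e x y -> starset A y.
Proof.
move=> xA; apply: contrapT => nA.
pose B (n : nat) (t : G) := [set y : G | d t y < n.+1%:R^-1 /\ ~ A y].
have [m n t mn y [ty Ay]|n|y yB] := @overspill V G G B x.
- split=> //; apply: lt_le_trans ty _.
  by rewrite lef_pV2 ?posrE ?ltr0n// ler_nat.
- have n0 : 0 < n.+1%:R^-1 :> R by rewrite invr_gt0 ltr0n.
  apply: contrapT => h; apply: nA; exists n.+1%:R^-1 => // y xy.
  apply: contrapT => nAy; apply: h; exists y.
  move: xy nAy; rewrite -starset_not /starnear.
  have [p [-> ->]] := star_split2 x y; rewrite !starrelE starsetE.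
  by apply: starset_app2 => t /= ? ?; split.
- have xy : monad x y.
    apply/approx_lP => e e0.
    pose n := Num.Def.archi_bound e^-1.
    have ne : n.+1%:R^-1 <= e.
      rewrite -(invrK e) lef_pV2 ?posrE ?ltr0n ?invr_gt0//.
      have := archi_boundP (ltW (etrans (invr_gt0 e) e0)).
      rewrite -/n => /ltW /le_trans; apply.
      by rewrite ler_nat.
    apply: (starnear_le ne); move: (yB n); rewrite /starnear.
    have [p [-> ->]] := star_split2 x y; rewrite !starrelE.
    by apply: starsetS => t /= [].
  have := xA _ xy; rewrite -[starset A y](notK) -starset_not; apply.
  move: (yB 0%N); have [p [-> ->]] := star_split2 x y.
  rewrite starrelE starsetE.
  by apply: starsetS => t /= [].
Qed.

Lemma finite_stardistP x y :
  finite_hyperreal (stardist x y) <-> exists c, starnear c x y.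
Proof.
rewrite /stardist /starnear.
have [p [-> ->]] := star_split2 x y; rewrite starmap2E.
split=> [/finite_hyperrealP[c]|[c]]; rewrite ?starsetE ?starrelE => h.
  exists (c + 1); rewrite starrelE; move: h; apply: starsetS => t /= h.
  by rewrite (le_lt_trans (ler_norm _))// (le_lt_trans h)// ltrDl.
apply/finite_hyperrealP; exists c; rewrite starsetE; move: h.
by apply: starsetS => t /= /ltW; rewrite ger0_norm// lim_dist_ge0.
Qed.

Lemma std_dist_near e x y : finite_hyperreal (stardist x y) ->
  standard_part (stardist x y) < e -> starnear e x y.
Proof.
move=> /standard_partP; move: (standard_part _) => s h se.
have e0 : 0 < (e - s) / 2 by rewrite divr_gt0// subr_gt0.
move: (h _ e0); rewrite /stardist /starnear.
have [p [-> ->]] := star_split2 x y; rewrite starmap2E starsetE starrelE.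
apply: starsetS => t /=; rewrite ler_distl => /andP[_].
move=> /le_lt_trans; apply; rewrite -ltrBrDl ltr_pdivrMr// ltr_pMr ?subr_gt0//.
by rewrite ltr1n.
Qed.

Lemma near_std_dist e x y : starnear e x y ->
  standard_part (stardist x y) <= e.
Proof.
move=> xye; have : finite_hyperreal (stardist x y).
  by apply/finite_stardistP; exists e.
move=> /standard_partP; move: (standard_part _) => s h.
rewrite leNgt; apply/negP => es.
have e0 : 0 < (s - e) / 2 by rewrite divr_gt0// subr_gt0.
suff: starset set0 (starpair x y).
  by rewrite -setCT starsetC; apply; apply: starsetT.
move: (h _ e0) xye; rewrite /stardist /starnear /starmap2 /starrel starsetE.
apply: starset_app2 => t /=; rewrite ler_distl => /andP[+ _] te.
move=> /le_lt_trans /(_ te).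
by rewrite ltrBlDr -ltrBlDl ltr_pdivlMr// gtr_pMr ?subr_gt0// ltrn1.
Qed.

End metric_monad.

Section hull_def.
Variables (V : nonstandard_universe) (R : realType) (G : topGroupType).
Variables (d : left_invariant_metric R G) (r : {posnum R}).

(* U_{d,f} for U = metric_ball d r *)
Definition hull_dom : set (star V G) :=
  [set x | [/\ starset (metric_ball d r%:num) x,
               monad x `<=` starset (metric_ball d r%:num) &
               finite_hyperreal (stardist d x (std V 1%g))]].

Lemma hull_domP x : hull_dom x <-> exists2 e : R, 0 < e &
  forall y, starnear d e x y -> starset (metric_ball d r%:num) y.
Proof.
split=> [[_ xU _]|[e e0 h]]; first exact: monad_underspill.
have xU : starset (metric_ball d r%:num) x by apply: h; apply: starnear_xx.
split=> //; first by move=> y /(approx_lP d) /(_ e e0); apply: h.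
apply/finite_stardistP; exists r%:num.
move: xU; rewrite -(starmap_cst 1%g x) -{1 2}(starmap_id x) /starnear.
by rewrite starrelE starsetE.
Qed.

Lemma hull_dom_near x : hull_dom x -> exists2 e : R, 0 < e &
  forall y, starnear d e x y -> hull_dom y.
Proof.
move=> /hull_domP[e e0 h]; exists (e / 2); first by rewrite divr_gt0.
move=> y xy; apply/hull_domP; exists (e / 2); first by rewrite divr_gt0.
by move=> z yz; apply: h; rewrite (splitr e); apply: starnear_trans yz.
Qed.

Lemma hull_dom_approx x y : approx_l x y -> hull_dom x -> hull_dom y.
Proof.
by move=> /(approx_lP d) xy /hull_dom_near[e e0 h]; apply: h; apply: xy.
Qed.

Lemma hull_dom1 : hull_dom (std V 1%g).
Proof.
apply/hull_domP; exists r%:num => // y; rewrite -(starmap_cst 1%g y).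
rewrite -{2 3}(starmap_id y) /starnear starrelE starsetE.
by apply: starsetS => t /=; rewrite (cm_sym (lim_compatible d)).
Qed.

Lemma hull_dom_finite x y : hull_dom x -> hull_dom y ->
  finite_hyperreal (stardist d x y).
Proof.
move=> [_ _ /finite_stardistP[a xa]] [_ _ /finite_stardistP[b yb]].
apply/finite_stardistP; exists (a + b).
by apply: starnear_trans xa _; apply: starnear_sym.
Qed.

Definition hull_set : set (set (star V G)) := [set monad x | x in hull_dom].

Definition hull : Type := set_type hull_set.

HB.instance Definition _ := gen_eqMixin hull.
HB.instance Definition _ := gen_choiceMixin hull.

Definition hull_one : hull := SigSub (mem_set (imageP monad hull_dom1)).

(* [x] for x in hull_dom; the value at other x is irrelevant. *)
Definition hull_class (x : star V G) : hull :=
  insubd (hull_one : set_type hull_set) (monad x).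

Lemma hull_classE x : hull_dom x -> val (hull_class x : set_type hull_set) = monad x.
Proof. by move=> xd; rewrite insubdK//; apply: mem_set; exists x. Qed.

Lemma hull_class1 : hull_class (std V 1%g) = hull_one.
Proof. by apply: val_inj; rewrite [LHS]hull_classE//; exact: hull_dom1. Qed.

Lemma hull_ex (a : hull) : exists2 x, hull_dom x & hull_class x = a.
Proof.
have [x xd xa] := set_valP (a : set_type hull_set); exists x => //.
by apply: val_inj; rewrite [LHS]hull_classE.
Qed.

Lemma hull_class_eqP x y : hull_dom x -> hull_dom y ->
  hull_class x = hull_class y <-> approx_l x y.
Proof.
move=> xd yd; rewrite -(monad_eqP d) -!hull_classE//.
by split=> [->//|]; apply: val_inj.
Qed.

Definition hull_repr (a : hull) : star V G := s2val (cid2 (hull_ex a)).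

Lemma hull_repr_dom a : hull_dom (hull_repr a).
Proof. exact: s2valP (cid2 (hull_ex a)). Qed.

Lemma hull_reprK a : hull_class (hull_repr a) = a.
Proof. exact: s2valP' (cid2 (hull_ex a)). Qed.

Lemma hull_repr_class x : hull_dom x -> approx_l (hull_repr (hull_class x)) x.
Proof.
move=> xd; apply/hull_class_eqP => //; first exact: hull_repr_dom.
by rewrite hull_reprK.
Qed.

(* hull_distE, hull_mulE and hull_invE below show that this distance and the
   operations hull_mul and hull_inv do not depend on the representatives. *)
Definition hull_dist (a b : hull) : R :=
  standard_part (stardist d (hull_repr a) (hull_repr b)).

Lemma hull_dist_near (a b : hull) e : hull_dist a b < e ->
  starnear d e (hull_repr a) (hull_repr b).
Proof.
move=> h; apply: std_dist_near h; apply: hull_dom_finite.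
  exact: hull_repr_dom.
exact: hull_repr_dom.
Qed.

Lemma hull_distE x y : hull_dom x -> hull_dom y ->
  hull_dist (hull_class x) (hull_class y) = standard_part (stardist d x y).
Proof.
move=> xd yd; rewrite /hull_dist.
have ax := hull_repr_class xd; have ay := hull_repr_class yd.
have ax' := hull_repr_dom (hull_class x); have ay' := hull_repr_dom (hull_class y).
move: (hull_repr (hull_class x)) (hull_repr (hull_class y)) ax ay ax' ay' => x' y' xx yy x'd y'd.
suff H u v u' v' : approx_l u u' -> approx_l v v' -> hull_dom u -> hull_dom v ->
  standard_part (stardist d u' v') <= standard_part (stardist d u v).
  apply/eqP; rewrite eq_le !H//; exact: (approx_l_sym d).
move=> /(approx_lP d) uu /(approx_lP d) vv ud vd; apply/ler_addgt0Pl => e e0.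
have e3 : 0 < e / 3 by rewrite divr_gt0.
rewrite (_ : e + _ = e / 3 + (e / 3 + standard_part (stardist d u v) + e / 3)).
  apply: near_std_dist; apply: starnear_trans (starnear_sym (uu _ e3)) _.
  apply: starnear_trans (vv _ e3).
  by apply: std_dist_near; [exact: hull_dom_finite|rewrite ltrDr].
by lra.
Qed.

Let hull_distxx (a : hull) : hull_dist a a = 0.
Proof.
apply/eqP; rewrite eq_le; apply/andP; split; apply/ler_addgt0Pl => e e0.
  by rewrite addr0; apply: near_std_dist; apply: starnear_xx.
rewrite leNgt; apply/negP => h.
have : starnear d 0 (hull_repr a) (hull_repr a).
  apply: hull_dist_near; rewrite -(ltrD2l e) addr0.
  by apply: lt_le_trans h _ => //; rewrite ltW.
rewrite -(starmap_id (hull_repr a)) /starnear starrelE => {}h.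
suff: starset set0 (hull_repr a).
  by rewrite -setCT starsetC; apply; apply: starsetT.
by apply: starsetS h => t /=; rewrite ltNge lim_dist_ge0.
Qed.

Let hull_dist_eq (a b : hull) : hull_dist a b = 0 -> a = b.
Proof.
move=> ab; rewrite -(hull_reprK a) -(hull_reprK b).
apply/hull_class_eqP; [exact: hull_repr_dom|exact: hull_repr_dom|].
by apply/(approx_lP d) => e e0; apply: hull_dist_near; rewrite ab.
Qed.

Let hull_dist_sym (a b : hull) : hull_dist a b = hull_dist b a.
Proof.
suff H a' b' : hull_dist a' b' <= hull_dist b' a' by apply/eqP; rewrite eq_le !H.
apply/ler_addgt0Pl => e e0; apply: near_std_dist; apply: starnear_sym.
by apply: hull_dist_near; rewrite ltrDr.
Qed.

Let hull_dist_triangle (b a c : hull) :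
  hull_dist a c <= hull_dist a b + hull_dist b c.
Proof.
apply/ler_addgt0Pl => e e0; have e2 : 0 < e / 2 by rewrite divr_gt0.
rewrite (_ : e + _ = (e / 2 + hull_dist a b) + (e / 2 + hull_dist b c)).
  apply: near_std_dist; apply: (@starnear_trans _ _ _ _ _ _ _ (hull_repr b)).
    by apply: hull_dist_near; rewrite ltrDr.
  by apply: hull_dist_near; rewrite ltrDr.
by rewrite addrACA -splitr.
Qed.

HB.instance Definition _ := @isMetric.Build R hull hull_dist
  hull_distxx hull_dist_eq hull_dist_sym hull_dist_triangle.

Definition hull_mul (a b : hull) : hull :=
  hull_class (starmul (hull_repr a) (hull_repr b)).

Definition hull_muldom : set (hull * hull) :=
  [set z | exists x y, [/\ hull_dom x, hull_dom y, hull_dom (starmul x y) &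
     z = (hull_class x, hull_class y)]].

Definition hull_inv (a : hull) : hull := hull_class (starinv (hull_repr a)).

Section local_uniformity.
Hypothesis Ulu : locally_uniform_on (metric_ball d r%:num).

Local Notation U := (metric_ball d r%:num).
Local Notation U2 := (set_power U 2).

Let dxx (t : G) : d t t = 0. Proof. exact: cm_xx (lim_compatible d) t. Qed.
Let dsym (s t : G) : d s t = d t s.
Proof. exact: cm_sym (lim_compatible d) s t. Qed.
Let dinv1 (t : G) : d t^-1%g 1%g = d t 1%g.
Proof. by rewrite -(lim_left_invariant d t) mulgV mulg1 dsym. Qed.

Let U1 : U 1%g. Proof. by rewrite /metric_ball/= dxx. Qed.

Let UV t : U t -> U t^-1%g. Proof. by rewrite /metric_ball/= dinv1. Qed.

Let U2M s t : U s -> U t -> U2 (s * t)%g.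
Proof.
move=> Us Ut; exists (fun i : 'I_2 => if val i == 0%N then s else t).
  by move=> i; case: ifP.
by rewrite !big_ord_recl big_ord0 /= mulg1.
Qed.

Let U2U s : U s -> U2 s.
Proof. by move=> Us; rewrite -(mulg1 s); apply: U2M. Qed.

Section closeness.
Variables (E : set_system (G * G)).
Hypothesis cE : compatible_uniformity E.
Hypothesis ucE : forall W, E W -> exists2 W', E W' & forall x x' y y' : G,
    U2 x -> U2 x' -> U2 y -> U2 y' ->
    W' (x, x') -> W' (y, y') -> W ((x * y)%g, (x' * y')%g).
Variables (P : Type) (p : star V P).
Implicit Types f g h : P -> G.

Let EC f g := forall W, E W -> starset [set t | W (f t, g t)] p.

(* f p is infinitely close to the identity *)
Let SM f := forall e : R, 0 < e -> starset [set t | d (f t) 1%g < e] p.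

Let EC_refl f : EC f f.
Proof.
by move=> W EW; apply: starset_all => t /=; apply: (cu_diagonal cE EW).
Qed.

Let EC_sym f g : EC f g -> EC g f.
Proof.
by move=> fg W EW; have := fg _ (cu_inv cE EW); apply: starsetS => t.
Qed.

Let EC_trans g f h : EC f g -> EC g h -> EC f h.
Proof.
move=> fg gh W EW; have [W' EW' WW] := cu_split cE EW.
apply: (starset_app2 _ (fg _ EW') (gh _ EW')) => t /= ? ?.
by apply: WW; exists (g t).
Qed.

Let EC_mul f f' g g' :
  starset [set t | U2 (f t) /\ U2 (f' t)] p ->
  starset [set t | U2 (g t) /\ U2 (g' t)] p ->
  EC f f' -> EC g g' ->
  EC (fun t => f t * g t)%g (fun t => f' t * g' t)%g.
Proof.
move=> uf ug ff gg W EW; have [W' EW' WW] := ucE EW.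
have h1 := starset_app2 (fun t a b => conj a b) uf ug.
have h2 := starset_app2 (fun t a b => conj a b) (ff _ EW') (gg _ EW').
by apply: (starset_app2 _ h1 h2) => t [[] ? ? []] ? ? [] ? ? /=; apply: WW.
Qed.

Let EC_SM f : EC (fun=> 1%g) f <-> SM f.
Proof.
split=> [h e e0|h W EW].
  have : nbhs (1%g : G) [set t : G | d t 1%g < e].
    by apply/(cm_nbhs (lim_compatible d)); exists e => // t /=; rewrite dsym.
  rewrite (cu_nbhs cE) => -[W EW We]; have := h W EW.
  by apply: starsetS => t /= /mem_set Wt; apply: We; rewrite /xsection/= .
have : nbhs (1%g : G) [set t : G | W (1%g, t)].
  by rewrite (cu_nbhs cE); exists W => // t; rewrite /xsection/= inE.
move=> /(cm_nbhs (lim_compatible d))[e e0 eW].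
by apply: starsetS (h e e0) => t /=; rewrite dsym; apply: eW.
Qed.

Let SM_U f : SM f -> starset [set t | U (f t)] p.
Proof. by move=> /(_ r%:num); apply. Qed.

Let UU f g : starset [set t | U (f t)] p -> starset [set t | U (g t)] p ->
  starset [set t | U (f t) /\ U (g t)] p.
Proof. exact: starset_app2. Qed.

Let SM_EC f g : starset [set t | U (f t)] p -> starset [set t | U (g t)] p ->
  SM (fun t => (f t)^-1 * g t)%g <-> EC f g.
Proof.
move=> Uf Ug; have Ufg := UU Uf Ug; split=> [/EC_SM h|h].
  have -> : f = (fun t => f t * 1)%g by apply/funext => t; rewrite mulg1.
  have -> : g = (fun t => f t * ((f t)^-1 * g t))%g.
    by apply/funext => t; rewrite mulVKg.
  apply: EC_mul => //; first by apply: starsetS Uf => t /= /U2U.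
  move: Ufg; apply: starsetS => t /= [? ?]; split; first exact: U2U.
  by apply: U2M => //; apply: UV.
apply/EC_SM.
have -> : (fun=> 1%g) = (fun t => (f t)^-1 * f t)%g.
  by apply/funext => t; rewrite mulVg.
apply: EC_mul => //; first by apply: starsetS Uf => t /= /UV /U2U.
by apply: starsetS Ufg => t /= [/U2U ? /U2U].
Qed.

Lemma SM_conj f g m : starset [set t | U (f t)] p ->
  starset [set t | U (g t)] p -> SM (fun t => (f t)^-1 * g t)%g -> SM m ->
  SM (fun t => (f t)^-1 * m t * g t)%g.
Proof.
move=> Uf Ug fg sm; apply/EC_SM; have Um := SM_U sm.
move/EC_SM: (fg) => /EC_trans; apply.
have Ufg := UU Uf Ug; have Ufm := UU Uf Um.
apply: EC_mul => //.
- by apply: starsetS Ufm => t /= [/UV ? ?]; split; [exact: U2U|exact: U2M].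
- by apply: starsetS Ug => t /= /U2U.
have {1}-> : (fun t => (f t)^-1)%g = (fun t => (f t)^-1 * 1)%g.
  by apply/funext => t; rewrite mulg1.
apply: EC_mul => //; last exact/EC_SM.
  by apply: starsetS Uf => t /= /UV /U2U.
by apply: starsetS Um => t /= /U2U; split=> //; exact: U2U.
Qed.

End closeness.

Let dE (s t : G) : d (s^-1 * t)%g 1%g = d s t.
Proof. by rewrite -(lim_left_invariant d s) mulVKg mulg1 dsym. Qed.

Let conj_small (P : Type) (p : star V P) (f g m : P -> G) :
  starset [set t | U (f t)] p -> starset [set t | U (g t)] p ->
  (forall e, 0 < e -> starset [set t | d (f t) (g t) < e] p) ->
  (forall e, 0 < e -> starset [set t | d (m t) 1%g < e] p) ->
  forall e, 0 < e -> starset [set t | d ((f t)^-1 * m t * g t)%g 1%g < e] p.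
Proof.
have [E [cE ucE]] := Ulu => Uf Ug fg m1; apply: (SM_conj cE ucE Uf Ug) => //.
by move=> e e0; apply: starsetS (fg e e0) => t /=; rewrite dE.
Qed.

Let close_mul (P : Type) (p : star V P) (f f' g g' : P -> G) :
  starset [set t | U (g t)] p -> starset [set t | U (g' t)] p ->
  (forall e, 0 < e -> starset [set t | d (f t) (f' t) < e] p) ->
  (forall e, 0 < e -> starset [set t | d (g t) (g' t) < e] p) ->
  forall e, 0 < e ->
    starset [set t | d (f t * g t)%g (f' t * g' t)%g < e] p.
Proof.
move=> Ug Ug' ff gg e e0.
have ff' c : 0 < c -> starset [set t | d ((f t)^-1 * f' t)%g 1%g < c] p.
  by move=> /ff; apply: starsetS => t /=; rewrite dE.
apply: starsetS (conj_small Ug Ug' gg ff' e0) => t /=.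
by rewrite -[d (f t * _)%g _]dE invgM !mulgA.
Qed.

Let close_inv (P : Type) (p : star V P) (f g : P -> G) :
  starset [set t | U (f t)] p ->
  (forall e, 0 < e -> starset [set t | d (f t) (g t) < e] p) ->
  forall e, 0 < e -> starset [set t | d (f t)^-1%g (g t)^-1%g < e] p.
Proof.
move=> Uf fg e e0.
have Uf' : starset [set t | U (f t)^-1%g] p by apply: starsetS Uf => t /UV.
have ff c : 0 < c -> starset [set t | d (f t)^-1%g (f t)^-1%g < c] p.
  by move=> c0; apply: starset_all => t /=; rewrite dxx.
have gf c : 0 < c -> starset [set t | d ((g t)^-1 * f t)%g 1%g < c] p.
  by move=> /fg; apply: starsetS => t /=; rewrite dE dsym.
apply: starsetS (conj_small Uf' Uf' ff gf e0) => t /=.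
by rewrite -[d (f t)^-1%g _]dE !invgK mulgA mulgK.
Qed.

Let inv_small (e : R) : 0 < e -> exists n : nat, n.+1%:R^-1 <= e.
Proof.
move=> e0; exists (Num.Def.archi_bound e^-1).
rewrite -{2}(invrK e) lef_pV2 ?posrE ?ltr0n ?invr_gt0//.
have := archi_boundP (ltW (etrans (invr_gt0 e) e0)).
by move=> /ltW /le_trans; apply; rewrite ler_nat.
Qed.

Let inv_dec (m n : nat) : (m <= n)%N -> n.+1%:R^-1 <= m.+1%:R^-1 :> R.
Proof. by move=> mn; rewrite lef_pV2 ?posrE ?ltr0n// ler_nat. Qed.

Let std_overspill (X : Type) (B : nat -> set X) :
  (forall m n, (m <= n)%N -> B n `<=` B m) -> (forall n, B n !=set0) ->
  exists x : star V X, forall n, starset (B n) x.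
Proof.
move=> Bd B0.
have E n (x : star V X) :
    starrel (fun y (_ : unit) => B n y) x (std V tt) = starset (B n) x.
  by rewrite -(starmap_cst tt x) -{1}(starmap_id x) starrelE.
have [m n t|n|x xB] := @overspill V X unit (fun n _ => B n) (std V tt).
- exact: Bd.
- by have [x xn] := B0 n; exists (std V x); rewrite E; apply/starset_std.
- by exists x => n; rewrite -E.
Qed.

Lemma metric_mul_uc (e : R) : 0 < e -> exists2 c : R, 0 < c &
  forall x x' y y' : G, U y -> U y' ->
    d x x' < c -> d y y' < c -> d (x * y)%g (x' * y')%g < e.
Proof.
move=> e0; apply: contrapT => nc.
pose B (n : nat) := [set t : G * G * G * G |
  [/\ U t.1.2 /\ U t.2, d t.1.1.1 t.1.1.2 < n.+1%:R^-1,
      d t.1.2 t.2 < n.+1%:R^-1 &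
      ~ d (t.1.1.1 * t.1.2)%g (t.1.1.2 * t.2)%g < e]].
have [m n mn t [? h1 h2 ?]|n|q qB] := @std_overspill _ B.
- by split=> //; [apply: lt_le_trans h1 _|apply: lt_le_trans h2 _];
    exact: inv_dec.
- apply: contrapT => nB; apply: nc; exists n.+1%:R^-1.
    by rewrite invr_gt0 ltr0n.
  move=> x x' y y' ? ? ? ?; apply: contrapT => h; apply: nB.
  by exists (x, x', y, y').
- suff: starset set0 q by rewrite -setCT starsetC; apply; apply: starsetT.
  have h (c : R) : 0 < c -> starset [set t : G * G * G * G |
      d t.1.1.1 t.1.1.2 < c /\ d t.1.2 t.2 < c] q.
    move=> /inv_small[n nc']; apply: starsetS (qB n) => t /= [_ h1 h2 _].
    by split; [apply: lt_le_trans h1 _|apply: lt_le_trans h2 _].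
  have U3 : starset [set t : G * G * G * G | U t.1.2] q.
    by apply: starsetS (qB 0%N) => t [[]].
  have U4 : starset [set t : G * G * G * G | U t.2] q.
    by apply: starsetS (qB 0%N) => t [[]].
  apply: (starset_app2 _ (qB 0%N)
    (@close_mul _ q (fun t => t.1.1.1) (fun t => t.1.1.2) (fun t => t.1.2)
      snd U3 U4 _ _ e e0)).
  + by move=> t [].
  + by move=> c /h; apply: starsetS => t [].
  + by move=> c /h; apply: starsetS => t [].
Qed.

Lemma metric_inv_uc (e : R) : 0 < e -> exists2 c : R, 0 < c &
  forall x x' : G, U x -> d x x' < c -> d x^-1%g x'^-1%g < e.
Proof.
move=> e0; apply: contrapT => nc.
pose B (n : nat) := [set t : G * G |
  [/\ U t.1, d t.1 t.2 < n.+1%:R^-1 & ~ d t.1^-1%g t.2^-1%g < e]].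
have [m n mn t [? h1 ?]|n|q qB] := @std_overspill _ B.
- by split=> //; apply: lt_le_trans h1 _; exact: inv_dec.
- apply: contrapT => nB; apply: nc; exists n.+1%:R^-1.
    by rewrite invr_gt0 ltr0n.
  move=> x x' ? ?; apply: contrapT => h; apply: nB.
  by exists (x, x').
- suff: starset set0 q by rewrite -setCT starsetC; apply; apply: starsetT.
  have h (c : R) : 0 < c -> starset [set t : G * G | d t.1 t.2 < c] q.
    move=> /inv_small[n nc']; apply: starsetS (qB n) => t /= [_ h1 _].
    exact: lt_le_trans h1 _.
  have U3 : starset [set t : G * G | U t.1] q.
    by apply: starsetS (qB 0%N) => t [].
  apply: (starset_app2 _ (qB 0%N) (@close_inv _ q fst snd U3 h e e0)).
  by move=> t [].
Qed.

Lemma starnear_mul (e : R) : 0 < e -> exists2 c : R, 0 < c &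
  forall x x' y y' : star V G, starset U y -> starset U y' ->
    starnear d c x x' -> starnear d c y y' ->
    starnear d e (starmul x y) (starmul x' y').
Proof.
move=> /metric_mul_uc[c c0 h]; exists c => // x x' y y'.
have [p [-> -> -> ->]] := star_split4 x x' y y'.
rewrite /starmul /starnear !starmap2E !starrelE !starsetE => Uy Uy' xx yy.
have h1 := starset_app2 (fun t a b => conj a b) Uy Uy'.
have h2 := starset_app2 (fun t a b => conj a b) xx yy.
by apply: (starset_app2 _ h1 h2) => t /= [? ?] [? ?]; apply: h.
Qed.

Lemma starnear_inv (e : R) : 0 < e -> exists2 c : R, 0 < c &
  forall x x' : star V G, starset U x ->
    starnear d c x x' -> starnear d e (starinv x) (starinv x').
Proof.
move=> /metric_inv_uc[c c0 h]; exists c => // x x'.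
have [p [-> ->]] := star_split2 x x'.
rewrite /starinv /starnear !starmapE !starrelE !starsetE => Ux xx.
by apply: (starset_app2 _ Ux xx) => t /= ? ?; apply: h.
Qed.

Lemma approx_l_mul (x x' y y' : star V G) : starset U y -> starset U y' ->
  approx_l x x' -> approx_l y y' -> approx_l (starmul x y) (starmul x' y').
Proof.
move=> Uy Uy' /(approx_lP d) xx /(approx_lP d) yy; apply/(approx_lP d) => e.
by move=> /starnear_mul[c c0]; apply=> //; [exact: xx|exact: yy].
Qed.

Lemma approx_l_inv (x x' : star V G) : starset U x ->
  approx_l x x' -> approx_l (starinv x) (starinv x').
Proof.
move=> Ux /(approx_lP d) xx; apply/(approx_lP d) => e.
by move=> /starnear_inv[c c0]; apply=> //; exact: xx.
Qed.

Let starU_inv (x : star V G) : starset U x -> starset U (starinv x).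
Proof. by rewrite /starinv starsetE; apply: starsetS => t /UV. Qed.

Let starinvK (x : star V G) : starinv (starinv x) = x.
Proof.
rewrite /starinv starmapE -[RHS]starmap_id; apply: starmap_ext => t.
exact: invgK.
Qed.

Lemma hull_dom_inv (x : star V G) : hull_dom x -> hull_dom (starinv x).
Proof.
move=> xd; have [Ux xU _] := xd; split.
- exact: starU_inv.
- move=> y xy; rewrite -(starinvK y); apply: starU_inv; apply: xU.
  move: xy Ux; rewrite /monad/= /starinv.
  have [p [-> ->]] := star_split2 x y => xy; rewrite starsetE => Ux.
  apply/(approx_lP d) => e e0; move/(approx_lP d): xy.
  rewrite /starnear !starmapE starrelE => xy.
  have xx c : 0 < c -> starset [set t : G * G | d t.1 t.1 < c] p.
    by move=> c0; apply: starset_all => t /=; rewrite dxx.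
  have xy1 c : 0 < c -> starset [set t : G * G | d (t.1 * t.2)%g 1%g < c] p.
    move=> /xy; rewrite starrelE; apply: starsetS => t /=.
    by rewrite -dE invgK.
  apply: starsetS (conj_small Ux Ux xx xy1 e0) => t /=.
  by rewrite mulKg -[d t.1 _]dE -invgM dinv1.
- have [_ _ /finite_stardistP[c h]] := xd; apply/finite_stardistP.
  exists c; move: h; rewrite /starinv -(starmap_cst 1%g x).
  rewrite -{1 3}(starmap_id x) /starnear starmapE !starrelE.
  by apply: starsetS => t /=; rewrite dinv1.
Qed.

Let hull_domU (x : star V G) : hull_dom x -> starset U x. Proof. by case. Qed.

Lemma hull_mulE (x y : star V G) :
  hull_dom x -> hull_dom y -> hull_dom (starmul x y) ->
  hull_mul (hull_class x) (hull_class y) = hull_class (starmul x y).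
Proof.
move=> xd yd xyd.
have xx := hull_repr_class xd; have yy := hull_repr_class yd.
have xx' := hull_repr_dom (hull_class x).
have yy' := hull_repr_dom (hull_class y).
have h : approx_l (starmul (hull_repr (hull_class x))
    (hull_repr (hull_class y))) (starmul x y).
  by apply: approx_l_mul => //; apply: hull_domU.
apply/hull_class_eqP => //; apply: hull_dom_approx xyd.
exact: (approx_l_sym d).
Qed.

Lemma hull_muldomE (x y : star V G) : hull_dom x -> hull_dom y ->
  hull_muldom (hull_class x, hull_class y) <-> hull_dom (starmul x y).
Proof.
move=> xd yd; split=> [[x' [y' [x'd y'd xy' [xx yy]]]]|xyd]; last first.
  by exists x, y.
apply: hull_dom_approx xy'; apply: approx_l_mul; try exact: hull_domU.
  by apply/hull_class_eqP.
by apply/hull_class_eqP.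
Qed.

Lemma hull_invE (x : star V G) :
  hull_dom x -> hull_inv (hull_class x) = hull_class (starinv x).
Proof.
move=> xd; have xx := hull_repr_class xd.
have xx' := hull_repr_dom (hull_class x).
apply/hull_class_eqP; try exact: hull_dom_inv.
by apply: approx_l_inv => //; apply: hull_domU.
Qed.

Lemma hull_dist_lt (x y : star V G) (e : R) : hull_dom x -> hull_dom y ->
  hull_dist (hull_class x) (hull_class y) < e -> starnear d e x y.
Proof. by move=> xd yd; rewrite hull_distE//; apply/std_dist_near/hull_dom_finite. Qed.

Lemma hull_dist_le (x y : star V G) (e : R) : hull_dom x -> hull_dom y ->
  starnear d e x y -> hull_dist (hull_class x) (hull_class y) <= e.
Proof. by move=> xd yd; rewrite hull_distE//; exact: near_std_dist. Qed.

Lemma hull_ballE (a : hull) (e : R) : ball a e = [set b | hull_dist a b < e].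
Proof. by rewrite ballEmdist. Qed.

Lemma hull_hausdorff : hausdorff_space hull.
Proof. exact: metric_hausdorff. Qed.

Lemma hull_muldom_open : open hull_muldom.
Proof.
rewrite openE => -[_ _] [x [y [xd yd xyd [-> ->]]]].
have [e e0 he] := hull_dom_near xyd; have [c c0 hc] := starnear_mul e0.
exists (ball (hull_class x) c, ball (hull_class y) c).
  by split; apply: nbhsx_ballx.
move=> [a b] [/=]; rewrite !hull_ballE/=.
have [x' x'd <-] := hull_ex a; have [y' y'd <-] := hull_ex b.
move=> /(hull_dist_lt xd x'd) xx /(hull_dist_lt yd y'd) yy.
by apply/hull_muldomE => //; apply: he; apply: hc => //; apply: hull_domU.
Qed.

Lemma hull_mul_continuous :
  {within hull_muldom, continuous (fun z => hull_mul z.1 z.2)}.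
Proof.
rewrite continuous_open_subspace; last exact: hull_muldom_open.
move=> [_ _] /set_mem [x [y [xd yd xyd [-> ->]]]].
apply/cvg_ballP => e e0; have e2 : 0 < e / 2 by rewrite divr_gt0.
have [c c0 hc] := starnear_mul e2.
have : nbhs (hull_class x, hull_class y) hull_muldom.
  apply: open_nbhs_nbhs; split; first exact: hull_muldom_open.
  by exists x, y.
have : nbhs (hull_class x, hull_class y)
    [set z | ball (hull_class x) c z.1 /\ ball (hull_class y) c z.2].
  exists (ball (hull_class x) c, ball (hull_class y) c) => //.
  by split; apply: nbhsx_ballx.
apply: filterS2 => -[a b] /=; rewrite !hull_ballE/=.
have [x' x'd <-] := hull_ex a; have [y' y'd <-] := hull_ex b.
move=> [/(hull_dist_lt xd x'd) xx /(hull_dist_lt yd y'd) yy].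
move=> /(hull_muldomE x'd y'd) xyd'; rewrite !hull_mulE//.
apply: le_lt_trans (hull_dist_le _ _ (hc _ _ _ _ _ _ xx yy)) _ => //;
  try exact: hull_domU.
by rewrite ltr_pdivrMr// ltr_pMr// ltr1n.
Qed.

Lemma hull_inv_continuous : {within setT, continuous hull_inv}.
Proof.
rewrite continuous_open_subspace; last exact: openT.
move=> a _; have [x xd <-] := hull_ex a.
apply: (iffRL (@cvg_ballP R hull hull _ (nbhs_filter (hull_class x))
  hull_inv _)) => e e0.
have e2 : 0 < e / 2 by rewrite divr_gt0.
have [c c0 hc] := starnear_inv e2.
have xc : nbhs (hull_class x) (ball (hull_class x) c) by exact: nbhsx_ballx.
apply: (@filterS _ _ (nbhs_filter (hull_class x)) _ _ _ xc) => b /=.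
rewrite !hull_ballE/=; have [x' x'd <-] := hull_ex b.
move=> /(hull_dist_lt xd x'd) xx; rewrite !hull_invE//.
apply: le_lt_trans (hull_dist_le _ _ (hc _ _ _ xx)) _ => //;
  try exact: hull_domU; try exact: hull_dom_inv.
by rewrite ltr_pdivrMr// ltr_pMr// ltr1n.
Qed.

Let starmul1x (x : star V G) : starmul (std V 1%g) x = x.
Proof.
rewrite -(starmap_cst 1%g x) -{2 3}(starmap_id x) /starmul starmap2E.
by apply: starmap_ext => t; rewrite mul1g.
Qed.

Let starmulx1 (x : star V G) : starmul x (std V 1%g) = x.
Proof.
rewrite -(starmap_cst 1%g x) -{1 3}(starmap_id x) /starmul starmap2E.
by apply: starmap_ext => t; rewrite mulg1.
Qed.

Let starmulV (x : star V G) : starmul x (starinv x) = std V 1%g.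
Proof.
rewrite -(starmap_cst 1%g x) /starinv -{1}(starmap_id x) /starmul starmap2E.
by apply: starmap_ext => t; rewrite mulgV.
Qed.

Let starVmul (x : star V G) : starmul (starinv x) x = std V 1%g.
Proof. by rewrite -{2}(starinvK x) starmulV. Qed.

Let starmulA (x y z : star V G) :
  starmul (starmul x y) z = starmul x (starmul y z).
Proof.
have [p [-> -> ->]] := star_split3 x y z; rewrite /starmul !starmap2E.
by apply: starmap_ext => t; rewrite mulgA.
Qed.

Let hull_muldom1l (a : hull) : hull_muldom (hull_one, a).
Proof.
have [x xd <-] := hull_ex a; rewrite -hull_class1.
by apply/hull_muldomE; rewrite ?starmul1x//; exact: hull_dom1.
Qed.

Let hull_muldom1r (a : hull) : hull_muldom (a, hull_one).
Proof.
have [x xd <-] := hull_ex a; rewrite -hull_class1.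
by apply/hull_muldomE; rewrite ?starmulx1//; exact: hull_dom1.
Qed.

Let hull_mul1l (a : hull) : hull_mul hull_one a = a.
Proof.
have [x xd <-] := hull_ex a; rewrite -hull_class1.
by rewrite hull_mulE ?starmul1x//; exact: hull_dom1.
Qed.

Let hull_mul1r (a : hull) : hull_mul a hull_one = a.
Proof.
have [x xd <-] := hull_ex a; rewrite -hull_class1.
by rewrite hull_mulE ?starmulx1//; exact: hull_dom1.
Qed.

Let hull_muldomVr (a : hull) : [set: hull] a -> hull_muldom (a, hull_inv a).
Proof.
have [x xd <- _] := hull_ex a; rewrite hull_invE//.
apply/hull_muldomE; rewrite ?starmulV//; [exact: hull_dom_inv|exact: hull_dom1].
Qed.

Let hull_muldomVl (a : hull) : [set: hull] a -> hull_muldom (hull_inv a, a).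
Proof.
have [x xd <- _] := hull_ex a; rewrite hull_invE//.
apply/hull_muldomE; rewrite ?starVmul//; [exact: hull_dom_inv|exact: hull_dom1].
Qed.

Let hull_mulVr (a : hull) : [set: hull] a -> hull_mul a (hull_inv a) = hull_one.
Proof.
have [x xd <- _] := hull_ex a; rewrite hull_invE// -hull_class1.
rewrite hull_mulE ?starmulV//; [exact: hull_dom_inv|exact: hull_dom1].
Qed.

Let hull_mulVl (a : hull) : [set: hull] a -> hull_mul (hull_inv a) a = hull_one.
Proof.
have [x xd <- _] := hull_ex a; rewrite hull_invE// -hull_class1.
rewrite hull_mulE ?starVmul//; [exact: hull_dom_inv|exact: hull_dom1].
Qed.

Let hull_mulA (a b c : hull) :
  hull_muldom (a, b) -> hull_muldom (b, c) ->
  hull_muldom (hull_mul a b, c) -> hull_muldom (a, hull_mul b c) ->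
  hull_mul (hull_mul a b) c = hull_mul a (hull_mul b c).
Proof.
have [x xd <-] := hull_ex a; have [y yd <-] := hull_ex b.
have [z zd <-] := hull_ex c.
move=> /(hull_muldomE xd yd) xy /(hull_muldomE yd zd) yz.
rewrite (hull_mulE xd yd xy) (hull_mulE yd zd yz).
move=> /(hull_muldomE xy zd) xyz /(hull_muldomE xd yz) xyz'.
by rewrite !hull_mulE// starmulA.
Qed.

Definition metric_hull : localGroup := {|
  lg_sort := hull;
  lg_one := hull_one;
  lg_mul := hull_mul;
  lg_muldom := hull_muldom;
  lg_inv := hull_inv;
  lg_invdom := setT;
  lg_hausdorff := hull_hausdorff;
  lg_muldom_open := hull_muldom_open;
  lg_mul_continuous := hull_mul_continuous;
  lg_invdom_open := openT;
  lg_inv_continuous := hull_inv_continuous;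
  lg_invdom1 := I;
  lg_muldom1l := hull_muldom1l;
  lg_muldom1r := hull_muldom1r;
  lg_mul1l := hull_mul1l;
  lg_mul1r := hull_mul1r;
  lg_muldomVr := hull_muldomVr;
  lg_muldomVl := hull_muldomVl;
  lg_mulVr := hull_mulVr;
  lg_mulVl := hull_mulVl;
  lg_mulA := hull_mulA
|}.

End local_uniformity.

End hull_def.

(* Main.v *)
Require Import Defs.
From mathcomp Require Import all_boot all_order all_algebra.
From mathcomp Require Import classical_sets functions.
From mathcomp Require Import interval_inference reals topology.

Set Implicit Arguments.
Unset Strict Implicit.
Unset Printing Implicit Defensive.

Import Order.TTheory GRing.Theory Num.Theory.

Local Open Scope classical_set_scope.
Local Open Scope ring_scope.

(** The points of both hulls are monads, and the relation [approx_l] refers only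
    to the topology of G, not to a metric. So a class [x] with x in
    U_{d,f} `&` U'_{d',f} is literally a point of both hulls, and the local
    isomorphism is the identity on these common classes: they form the
    neighborhood M in the first hull and the neighborhood N in the second.

    The algebra is then immediate, since the operations of both hulls are
    induced by those of G^*, and since a product [x][y] is defined and stays
    among the common classes in one hull exactly when it does so in the other:
    in either case this says that xy lies in U_{d,f} `&` U'_{d',f}
    ([hull_common_mulP]).

    The topology is the one place where d and d' have to be compared. Being
    compatible with the same topology they have comparable balls around the
    identity, and left invariance moves this comparison to every point, so they
    are uniformly equivalent on G ([left_invariant_metric_unif]), and by transfer
    on G^* ([starnear_unif]). Hence the set of common classes is open
    ([hull_common_open]) and the identification is continuous in both directions
    ([hull_change_continuous]). *)

Lemma lg_restrict_continuous (H K : localGroup) (M : set H) (N : set K)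
    (hM : lg_symmetric_open_nbhd M) (hN : lg_symmetric_open_nbhd N)
    (f : H -> K) :
  (forall x, M x -> N (f x)) -> {in M, continuous f} ->
  continuous (fun x : lg_restrict hM =>
    lgr_in hN (f (set_val x)) : lg_restrict hN).
Proof.
move=> fMN fc; have oM : open M by case: hM.
apply/continuousP => _ /lgr_openP[B oB <-]; apply/lgr_openP.
exists (M `&` f @^-1` B); first exact: (continuous_inP f oM).1 fc B oB.
apply/seteqP; split=> x; rewrite /preimage/=.
  by move=> [Mx fx]; rewrite lgr_inK//; exact: fMN.
have Mx := lgr_valP x.
by rewrite lgr_inK; [split|exact: fMN].
Qed.

(** The restrictions have subtypes as carriers; this reduces an isomorphism
    between them to conditions on functions between the ambient spaces. The
    product domain of a restriction also requires the product to stay inside, so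
    both conditions have to correspond jointly, not separately. *)
Lemma lg_restrict_isomorphic (H K : localGroup) (M : set H) (N : set K)
    (hM : lg_symmetric_open_nbhd M) (hN : lg_symmetric_open_nbhd N)
    (f : H -> K) (g : K -> H) :
  (forall x, M x -> N (f x)) -> (forall y, N y -> M (g y)) ->
  {in M, cancel f g} -> {in N, cancel g f} ->
  {in M, continuous f} -> {in N, continuous g} ->
  f (lg_one H) = lg_one K ->
  (forall x, M x -> f (lg_inv x) = lg_inv (f x)) ->
  (forall x y, M x -> M y -> lg_muldom H (x, y) /\ M (lg_mul x y) <->
    lg_muldom K (f x, f y) /\ N (lg_mul (f x) (f y))) ->
  (forall x y, M x -> M y -> lg_muldom H (x, y) -> M (lg_mul x y) ->
    f (lg_mul x y) = lg_mul (f x) (f y)) ->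
  lg_isomorphic (lg_restrict hM) (lg_restrict hN).
Proof.
move=> fMN gNM fK gK fc gc f1 fV fD fM.
exists (fun x => lgr_in hN (f (set_val x))).
exists (fun y => lgr_in hM (g (set_val y))).
have fval x : set_val (lgr_in hN (f (set_val x))) = f (set_val (x : M)).
  by rewrite lgr_inK//; apply: fMN; exact: lgr_valP.
split; split.
- move=> x; apply: lgr_val_inj; have Mx := lgr_valP x.
  rewrite fval lgr_inK; last by apply: gNM; exact: fMN.
  by rewrite fK// inE.
- move=> y; apply: lgr_val_inj; have Ny := lgr_valP y.
  rewrite lgr_inK lgr_inK//; try exact: gNM.
    by rewrite gK// inE.
  by rewrite gK// inE.
- exact: lg_restrict_continuous.
- exact: lg_restrict_continuous.
- apply: lgr_val_inj; rewrite fval; exact: f1.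
- by [].
- move=> x _; apply: lgr_val_inj; rewrite fval /= /lgr_inv fval.
  rewrite lgr_inK; last exact: lgr_inv_in.
  rewrite fV; last exact: lgr_valP.
  rewrite lgr_inK// -fV; last exact: lgr_valP.
  by apply: fMN; exact: lgr_inv_in.
- move=> x y; rewrite /= /lgr_muldom/= !fval; apply: fD; exact: lgr_valP.
- move=> x y [/= xy Mxy]; apply: lgr_val_inj.
  have Mx := lgr_valP x; have My := lgr_valP y.
  rewrite fval /= /lgr_mul !fval lgr_inK// fM// lgr_inK//.
  by rewrite -fM//; exact: fMN.
Qed.

Section common_hull.
Variables (R : realType) (V : nonstandard_universe) (G : topGroupType).
Implicit Types (d : left_invariant_metric R G) (r : {posnum R}).

(** Compatibility compares the balls around the identity, with a constant that
    is uniform because left translations are isometries for both metrics. *)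
Lemma left_invariant_metric_unif d d' (e : R) : 0 < e -> exists2 c : R, 0 < c &
  forall s t : G, d s t < c -> d' s t < e.
Proof.
move=> e0; have [c c0 h] : exists2 c : R, 0 < c &
    [set t | d 1%g t < c] `<=` [set t | d' 1%g t < e].
  by apply/(cm_nbhs (lim_compatible d))/(cm_nbhs (lim_compatible d')); exists e.
exists c => // s t st.
by rewrite -(lim_left_invariant d' s^-1%g) mulVg; apply: h;
  rewrite /= -(mulVg s) lim_left_invariant.
Qed.

Lemma starnear_unif d d' (e : R) : 0 < e -> exists2 c : R, 0 < c &
  forall x y : star V G, starnear d c x y -> starnear d' e x y.
Proof.
move=> /(left_invariant_metric_unif d d')[c c0 h]; exists c => // x y.
by apply: starsetS => t; exact: h.
Qed.

(** The classes common to both hulls, as points of the hull for d. *)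
Definition hull_common d r d' r' : set (hull V d r) :=
  [set hull_class d r x | x in hull_dom d r `&` hull_dom d' r'].

(** The identification of common classes. Classes outside [hull_common] are sent
    to the identity, the default value of [hull_class]. *)
Definition hull_change d r d' r' (a : hull V d r) : hull V d' r' :=
  hull_class d' r' (hull_repr a).

Lemma hull_commonE d r d' r' (x : star V G) : hull_dom d r x ->
  hull_common d' r' (hull_class d r x) <-> hull_dom d' r' x.
Proof.
move=> xd; split=> [[y [yd yd']]|xd']; last by exists x.
by move=> /(hull_class_eqP yd xd) yx; exact: hull_dom_approx yd'.
Qed.

Lemma hull_changeE d r d' r' (x : star V G) :
  hull_dom d r x -> hull_dom d' r' x ->
  hull_change d' r' (hull_class d r x) = hull_class d' r' x.
Proof.
move=> xd xd'; have xx := hull_repr_class xd.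
apply/hull_class_eqP => //; apply: hull_dom_approx xd'.
exact: (approx_l_sym d).
Qed.

Lemma hull_change_common d r d' r' (a : hull V d r) :
  hull_common d' r' a -> hull_common d r (hull_change d' r' a).
Proof. by move=> [x [xd xd'] <-]; rewrite hull_changeE//; exists x. Qed.

Lemma hull_changeK d r d' r' :
  {in @hull_common d r d' r',
    cancel (@hull_change d r d' r') (@hull_change d' r' d r)}.
Proof. by move=> a /set_mem[x [xd xd'] <-]; rewrite !hull_changeE. Qed.

(** If [x] is a common class, then a point y that is d-close to x is also
    d'-close to it, hence still in the d'-domain. *)
Lemma hull_common_open d r d' r' : open (@hull_common d r d' r').
Proof.
rewrite openE => _ [x [xd xd'] <-].
have [e e0 he] := hull_dom_near xd'; have [c c0 hc] := starnear_unif d d' e0.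
apply/nbhs_ballP; exists c => // b; rewrite hull_ballE /=.
have [y yd <-] := hull_ex b => /(hull_dist_lt xd yd) xy.
by apply/hull_commonE => //; apply: he; exact: hc.
Qed.

Lemma hull_change_continuous d r d' r' :
  {in @hull_common d r d' r', continuous (@hull_change d r d' r')}.
Proof.
move=> a /set_mem ac.
have oc := open_nbhs_nbhs (conj (@hull_common_open d r d' r') ac).
move: ac oc => [x [xd xd'] <-] oc.
apply: (iffRL (@cvg_ballP R _ _ _ (nbhs_filter (hull_class d r x))
  (hull_change d' r') _)) => e e0.
have e2 : 0 < e / 2 by rewrite divr_gt0.
have [c c0 hc] := starnear_unif d d' e2.
have bc : nbhs (hull_class d r x) (ball (hull_class d r x) c).
  exact: nbhsx_ballx.
apply: (@filterS2 _ _ (nbhs_filter (hull_class d r x)) _ _ _ _ oc bc).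
move=> _ [y [yd yd'] <-]; rewrite !hull_ballE/= => xy; rewrite !hull_changeE//.
(* The distance on the hull only gives a weak inequality, hence e / 2. *)
apply: le_lt_trans (hull_dist_le xd' yd' (hc _ _ (hull_dist_lt xd yd xy))) _.
by rewrite ltr_pdivrMr// ltr_pMr// ltr1n.
Qed.

Lemma hull_common_nbhd d r d' r'
    (dU : locally_uniform_on (metric_ball d r%:num))
    (dU' : locally_uniform_on (metric_ball d' r'%:num)) :
  @lg_symmetric_open_nbhd (metric_hull V dU) (hull_common d' r').
Proof.
have inv a :
    hull_common d' r' a -> hull_common d' r' (hull_inv (a : hull V d r)).
  move=> [x [xd xd'] <-]; exists (starinv x); last by rewrite hull_invE.
  by split; exact: hull_dom_inv.
split=> [||]; first exact: hull_common_open.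
  exists (std V 1%g); last exact: hull_class1.
  by split; exact: hull_dom1.
split=> //; apply/seteqP; split=> [_ [a ac <-]|a ac]; first exact: inv.
exists (hull_inv (a : hull V d r)); first exact: inv.
have [x xd xa] := hull_ex (a : hull V d r).
rewrite /= -xa (hull_invE dU)// (hull_invE dU); last exact: hull_dom_inv.
congr hull_class; rewrite /starinv starmapE -[RHS]starmap_id.
by apply: starmap_ext => t; exact: invgK.
Qed.

(** Its right-hand side is symmetric in the two metrics, which is what makes the
    product domains of the two restrictions correspond. *)
Lemma hull_common_mulP d r d' r'
    (dU : locally_uniform_on (metric_ball d r%:num)) (x y : star V G) :
  hull_dom d r x -> hull_dom d r y ->
  hull_muldom (hull_class d r x, hull_class d r y) /\
    hull_common d' r' (hull_mul (hull_class d r x) (hull_class d r y)) <->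
  hull_dom d r (starmul x y) /\ hull_dom d' r' (starmul x y).
Proof.
move=> xd yd; split=> [[/(hull_muldomE dU xd yd) xyd]|[xyd xyd']].
  by rewrite hull_mulE// => /hull_commonE xyd'; split; last exact: xyd'.
split; first exact/hull_muldomE.
by rewrite hull_mulE//; apply/hull_commonE.
Qed.

End common_hull.

Theorem proposition3p12 (R : realType) (V : nonstandard_universe)
    (G : topGroupType) (Gmetrizable : metrizable R G)
    (Gluniform : locally_uniform G)
    (d d' : left_invariant_metric R G) (r r' : {posnum R})
    (dU : locally_uniform_on (metric_ball d r%:num))
    (dU' : locally_uniform_on (metric_ball d' r'%:num)) :
  lg_locally_isomorphic (metric_hull V dU) (metric_hull V dU').
Proof.
exists (@hull_common R V G d r d' r'), (@hull_common R V G d' r' d r).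
exists (hull_common_nbhd V dU dU'), (hull_common_nbhd V dU' dU).
apply: (@lg_restrict_isomorphic (metric_hull V dU) (metric_hull V dU') _ _ _ _
  (@hull_change R V G d r d' r') (@hull_change R V G d' r' d r)).
- exact: hull_change_common.
- exact: hull_change_common.
- exact: hull_changeK.
- exact: hull_changeK.
- exact: hull_change_continuous.
- exact: hull_change_continuous.
- have := hull_changeE (hull_dom1 V d r) (hull_dom1 V d' r').
  by rewrite !hull_class1.
- move=> _ [x [xd xd'] <-] /=.
  by rewrite hull_changeE// !hull_invE// hull_changeE//; exact: hull_dom_inv.
- move=> _ _ [x [xd xd'] <-] [y [yd yd'] <-] /=; rewrite !hull_changeE//.
  rewrite (hull_common_mulP _ _ dU)// (hull_common_mulP _ _ dU')//.
  by split=> -[].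
- move=> _ _ [x [xd xd'] <-] [y [yd yd'] <-] /= xy xyc.
  have [xyd xyd'] := (hull_common_mulP d' r' dU xd yd).1 (conj xy xyc).
  by rewrite (hull_mulE dU)// !hull_changeE// (hull_mulE dU').
Qed.
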